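(* If $\langle X,\preceq\rangle$ is a locally finite Borel quasi order, then $\mathrm{odim}_B(\langle X,\preceq\rangle)\leq\aleph_0$.
   Context: A quasi order on a set $P$ is a reflexive transitive relation $\leq$ on $P$; $\langle P,\leq\rangle$ is then called a quasi order. It is locally finite if for every $x\in P$ the set $\{y\in P:y\leq x\}$ is finite. A partial order is an irreflexive transitive relation. For a quasi order $\leq$ on $P$: $x \, E_{\leq} \, y$ iff ($x \leq y$ and $y \leq x$); $x<y$ iff ($x\leq y$ and $y \nleq x$); $<$ induces a partial order on $P/E_{\leq}$, also denoted $<$, by $[x]<[y]$ iff $x<y$. A quasi order $\langle P,\leq\rangle$ is Borel if $P$ is a Polish space and $\leq$ is a Borel subset of $P\times P$. A partial order $<'$ on a set $Q$ extends a partial order $<$ on $Q$ if $<\ \subseteq\ <'$. Borel order dimension: let $\mathcal{P}=\langle P,\leq\rangle$ be a Borel quasi order. A partial order $\prec$ on $P/E_{\leq}$ is Borel if there is a Borel quasi order $\preceq'$ on $P$ with $E_{\preceq'}=E_{\leq}$ such that $\prec$ is the partial order on $P/E_{\preceq'}=P/E_{\leq}$ induced by $\preceq'$. $\mathrm{odim}_B(\mathcal{P})$ is the minimal cardinal $\kappa$ such that there is a sequence $\langle <_i : i\in\kappa\rangle$ of Borel partial orders on $P/E_{\leq}$ extending $<$ such that for all $x,y\in P$ there is $i\in\kappa$ with ($[y]<_i[x]$ or $[x]<[y]$ or $[x]=[y]$). *)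

(* Defs.v *)
From mathcomp Require Import all_boot all_order all_algebra.
From mathcomp Require Import all_classical all_reals all_analysis.

Set Implicit Arguments.
Unset Strict Implicit.
Unset Printing Implicit Defensive.

Import Order.TTheory GRing.Theory Num.Theory.
Import numFieldNormedType.Exports.
Local Open Scope classical_set_scope.
Local Open Scope ring_scope.

Section Polish.
Variables (R : realType) (X : topologicalType).

Definition is_metric (d : X -> X -> R) :=
  [/\ forall x, d x x = 0,
      forall x y, d x y = 0 -> x = y,
      forall x y, d x y = d y x &
      forall x y z, d x z <= d x y + d y z].

Definition metric_compatible (d : X -> X -> R) :=
  forall A : set X,
    open A <-> forall x, A x -> exists2 e, 0 < e & [set y | d x y < e] `<=` A.

Definition metric_complete (d : X -> X -> R) :=
  forall u : nat -> X,
    (forall e, 0 < e -> exists N, forall m n,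
       (N <= m)%N -> (N <= n)%N -> d (u m) (u n) < e) ->
    exists l : X, u @ \oo --> l.

(* The metric is existentially quantified: being Polish is a property of the
   topology.  The empty space is allowed. *)
Definition polish :=
  (exists2 D : set X, countable D & dense D) /\
  (exists d, [/\ is_metric d, metric_compatible d & metric_complete d]).

End Polish.
Arguments polish R X : clear implicits.

(* Relations are [rel X]; with the classical axioms of MathComp-Analysis these
   are the same as arbitrary subsets of [X * X]. *)
Section QuasiOrder.
Variable X : Type.

Definition quasi_order (le : rel X) := reflexive le /\ transitive le.

Definition partial_order (lt : rel X) := irreflexive lt /\ transitive lt.

Definition locally_finite (le : rel X) :=
  forall x, finite_set [set y | le y x].

Definition qo_equiv (le : rel X) : rel X := fun x y => le x y && le y x.

Definition qo_lt (le : rel X) : rel X := fun x y => le x y && ~~ le y x.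

Definition eclass (le : rel X) (x : X) : set X := [set y | qo_equiv le x y].

Definition quot (le : rel X) : Type := set_type (range (eclass le)).

Definition cls (le : rel X) (x : X) : quot le :=
  exist _ (eclass le x) (mem_set (imageT (eclass le) x)).

(* Only used when [qo_equiv le' =2 qo_equiv le]; it then is the strict order
   induced by [le'] on the common quotient. *)
Definition induced_lt (le le' : rel X) : rel (quot le) := fun a b =>
  `[< exists x y, [/\ a = cls le x, b = cls le y & qo_lt le' x y] >].
Arguments induced_lt le le' _ _ : clear implicits.

Definition quot_lt (le : rel X) : rel (quot le) := induced_lt le le.
Arguments quot_lt le _ _ : clear implicits.

End QuasiOrder.
Arguments induced_lt {X} le le' _ _.
Arguments quot_lt {X} le _ _.

Section BorelDimension.
Variable X : topologicalType.

Definition borel_rel (r : rel X) :=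
  <<s (open : set (set (X * X))) >> [set p | r p.1 p.2].

Definition borel_quasi_order (le : rel X) := quasi_order le /\ borel_rel le.

Definition borel_partial_order (le : rel X) (lt : rel (quot le)) :=
  partial_order lt /\
  exists le' : rel X,
    [/\ borel_quasi_order le', qo_equiv le' =2 qo_equiv le &
        lt =2 induced_lt le le'].

Definition borel_realizer (le : rel X) (T : Type) (K : set T)
    (lts : T -> rel (quot le)) :=
  (forall i, K i ->
     borel_partial_order (lts i) /\ subrel (quot_lt le) (lts i)) /\
  (forall x y : X, exists2 i, K i &
     [\/ lts i (cls le y) (cls le x),
         quot_lt le (cls le x) (cls le y) |
         cls le x = cls le y]).

(* Cardinals are sets up to equipotence: [borel_odim le K] says that the
   Borel order dimension is the cardinal of [K]. *)
Definition borel_odim (le : rel X) (T : Type) (K : set T) :=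
  (exists lts : T -> rel (quot le), borel_realizer K lts) /\
  (forall (U : Type) (K' : set U),
     (exists lts : U -> rel (quot le), borel_realizer K' lts) -> (K #<= K')%card).

End BorelDimension.

(* Main.v *)
Require Import Defs.
From mathcomp Require Import all_boot all_order all_algebra.
From mathcomp Require Import all_classical all_reals all_analysis.
Local Open Scope classical_set_scope.
Local Open Scope card_scope.

Set Implicit Arguments.
Unset Strict Implicit.
Unset Printing Implicit Defensive.

(** If [B] is a Borel upper set of [le], putting the complement of [B] below
    [B], and keeping [le] inside each of the two pieces, gives a Borel quasi
    order with the same equivalence relation, whose strict order extends that
    of [le] and makes [y < x] whenever [x] is in [B] and [y] is not
    ([prioritize]).  So it is enough to find countably many Borel upper sets
    such that every pair with [~~ le x y] has one of them containing [x] but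
    not [y] ([separating_upper_sets], [upper_sets_realizer]).

    Fix a countable base [U] of [X].  A lower section [{x | le x y}] is finite,
    hence closed, so when [~~ le x y] some [U n] contains [x] and misses the
    lower section of [y]; that is, [y] is not in the upper closure [P n] of
    [U n].  The set [P n] is an upper set, but as a projection it is only known
    to be analytic, and must be replaced by a Borel upper set.

    Let [W] be the complement of [le].  The rectangles [U n * ~` P n] cover [W],
    so the analytic sets [W `\` (U n * ~` P n)] have empty intersection, and
    Novikov's separation theorem encloses them in Borel sets [B n] with empty
    intersection.  The second projection [A' n] of [W `\` B n] is then analytic
    and disjoint from [P n], and the sets [U n * A' n] still cover [W].
    Iterating Lusin's separation theorem yields a Borel upper set that contains
    [U n] and is disjoint from [A' n] ([upper_set_separation]).

    Analytic sets are images of closed subsets of the Baire space under maps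
    that are continuous there.  The facts about them that are needed are proved
    from that definition: closure properties, the analyticity of Borel sets, and
    Novikov's theorem.

    Finally the dimension has to exist as a cardinal: among the cardinals of
    index sets of realizers, one of which is countable, there is a least one
    ([card_minimum_countable]). *)

(** * Borel sets *)

Definition borel (Y : topologicalType) : set (set Y) := <<s open >>.

Section Borel.
Context {Y : topologicalType}.
Implicit Types A B : set Y.

Lemma borel_open A : open A -> borel A.
Proof. exact: sub_sigma_algebra. Qed.

Lemma borel_setC A : borel A -> borel (~` A).
Proof. rewrite -setTD; exact: sigma_algebraCD. Qed.

Lemma borel_set0 : borel (@set0 Y).
Proof. exact: sigma_algebra0. Qed.

Lemma borel_setT : borel [set: Y].
Proof. by apply: borel_open; exact: openT. Qed.

Lemma borel_bigcup (A : nat -> set Y) :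
  (forall n, borel (A n)) -> borel (\bigcup_n A n).
Proof. exact: sigma_algebra_bigcup. Qed.

Lemma borel_bigcap (A : nat -> set Y) :
  (forall n, borel (A n)) -> borel (\bigcap_n A n).
Proof.
move=> bA; rewrite -[\bigcap_n A n]setCK setC_bigcap.
by apply: borel_setC; apply: borel_bigcup => n; apply: borel_setC.
Qed.

Lemma borelU A B : borel A -> borel B -> borel (A `|` B).
Proof.
move=> bA bB; rewrite -bigcup2E; apply: borel_bigcup => -[|[|n]] //=.
exact: borel_set0.
Qed.

Lemma borelI A B : borel A -> borel B -> borel (A `&` B).
Proof.
move=> bA bB; rewrite -[A `&` B]setCK setCI.
by apply: borel_setC; apply: borelU; apply: borel_setC.
Qed.

Lemma borel_ind (P : set Y -> Prop) :
  (forall A, open A -> P A) -> (forall A, P A -> P (~` A)) ->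
  (forall A : nat -> set Y, (forall n, P (A n)) -> P (\bigcup_n A n)) ->
  forall A, borel A -> P A.
Proof.
move=> Po PC PU; apply: smallest_sub => //; split=> //.
- exact/Po/open0.
- by move=> A; rewrite setTD; exact: PC.
Qed.

End Borel.

Lemma borel_preimage (Y Z : topologicalType) (g : Z -> Y) (A : set Y) :
  continuous g -> borel A -> borel (g @^-1` A).
Proof.
move=> cg; move: A; apply: borel_ind => [A oA|A|A bA].
- by apply: borel_open; exact: open_comp.
- by rewrite preimage_setC; exact: borel_setC.
- by rewrite preimage_bigcup; exact: borel_bigcup.
Qed.

(** * Separation of points by open sets *)

Lemma hausdorff_separate (Y : topologicalType) (x y : Y) :
  hausdorff_space Y -> x <> y ->
  exists U V : set Y,
    [/\ open U, open V, U x, V y & forall z, U z -> V z -> False].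
Proof.
rewrite open_hausdorff => hY /eqP /hY[[U V] /= [Ux Vy] [oU oV UV0]].
exists U, V; split=> //; [exact: set_mem|exact: set_mem|].
by move=> z Uz Vz; have /eqP UV := UV0; have : (U `&` V) z by []; rewrite UV.
Qed.

Lemma hausdorff_prod (Y Z : topologicalType) :
  hausdorff_space Y -> hausdorff_space Z -> hausdorff_space (Y * Z)%type.
Proof.
move=> hY hZ [y z] [y' z'] cl; congr pair.
- apply: hY => A B Ay By.
  have [||[a b] [? ?]] := cl (fst @^-1` A) (fst @^-1` B); last by exists a.
  - exact: (@cvg_fst Y Z (nbhs y) (nbhs z)).
  - exact: (@cvg_fst Y Z (nbhs y') (nbhs z')).
- apply: hZ => A B Ay By.
  have [||[a b] [? ?]] := cl (snd @^-1` A) (snd @^-1` B); last by exists b.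
  - exact: (@cvg_snd Y Z (nbhs y) (nbhs z)).
  - exact: (@cvg_snd Y Z (nbhs y') (nbhs z')).
Qed.

(** * Analytic sets *)

Definition baire := nat -> nat.

(** The sets [[set b | agree n a b]] are the basic neighbourhoods of [a] in the
    product topology, so closedness and continuity are phrased with them. *)
Definition agree n (a b : baire) := forall k, (k < n)%N -> a k = b k.

Definition baire_closed (F : set baire) :=
  forall a, (forall n, exists2 b, F b & agree n a b) -> F a.

(** Continuity of the restriction of [f] to [F] only: the limit map by which a
    Polish space is coded makes sense only on the codes of Cauchy sequences. *)
Definition baire_continuous (Y : topologicalType) (F : set baire)
    (f : baire -> Y) :=
  forall a U, F a -> open U -> U (f a) ->
  exists n, forall b, F b -> agree n a b -> U (f b).

Definition analytic (Y : topologicalType) (A : set Y) :=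
  exists (F : set baire) (f : baire -> Y),
    [/\ baire_closed F, baire_continuous F f & A = f @` F].

Definition behead_baire (a : baire) : baire := fun k => a k.+1.

Definition cons_baire n (a : baire) : baire :=
  fun k => if k is k'.+1 then a k' else n.

(** A point of the Baire space codes a sequence of such points, by a pairing of
    the indices; [of_rows] is a section of this coding. *)
Definition row (a : baire) (n : nat) : baire := fun k => a (pickle (n, k)).

Definition of_rows (r : nat -> baire) : baire :=
  fun j => if unpickle j is Some (n, k) then r n k else 0.

Lemma of_rowsK r n : row (of_rows r) n = r n.
Proof. by apply/funext => k; rewrite /row /of_rows pickleK. Qed.

Lemma agreeW m n a b : (m <= n)%N -> agree n a b -> agree m a b.
Proof. by move=> mn ab k km; apply: ab; apply: leq_trans mn. Qed.

(** Uniform continuity of the projections of this coding. *)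
Lemma agree_row n m :
  exists N, forall a b, agree N a b -> agree m (row a n) (row b n).
Proof.
exists (\max_(k < m) (pickle (n, val k)).+1) => a b ab k km.
by apply: ab; exact: (leq_bigmax (Ordinal km)).
Qed.

Lemma agree_behead n a b : agree n.+1 a b ->
  a 0 = b 0 /\ agree n (behead_baire a) (behead_baire b).
Proof. by move=> ab; split=> [|k kn]; apply: ab. Qed.

Lemma analytic_choice (Y : topologicalType) (A : nat -> set Y) :
  (forall n, analytic (A n)) ->
  exists w : nat -> set baire * (baire -> Y), forall n,
    [/\ baire_closed (w n).1, baire_continuous (w n).1 (w n).2 &
      A n = (w n).2 @` (w n).1].
Proof.
move=> aA; suff /choice[w wP] : forall n, exists w : set baire * (baire -> Y),
    [/\ baire_closed w.1, baire_continuous w.1 w.2 & A n = w.2 @` w.1].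
  by exists w.
by move=> n; have [F [f ?]] := aA n; exists (F, f).
Qed.

Section AnalyticOps.
Context {Y : topologicalType}.
Implicit Types A B : set Y.

(** The first coordinate of a code says which of the sets it is for, and the
    remaining ones are a code in that set. *)
Lemma analytic_bigcup (A : nat -> set Y) :
  (forall n, analytic (A n)) -> analytic (\bigcup_n A n).
Proof.
move=> /analytic_choice[w wP].
exists [set a | (w (a 0)).1 (behead_baire a)],
  (fun a => (w (a 0)).2 (behead_baire a)); split.
- move=> a ha /=; have [cF _ _] := wP (a 0); apply: cF => n.
  by have [b Fb /agree_behead[ab0 abn]] := ha n.+1; exists (behead_baire b);
    rewrite // ab0.
- move=> a U Fa oU Ua; have [_ cf _] := wP (a 0).
  have [n nP] := cf _ _ Fa oU Ua; exists n.+1 => b Fb /agree_behead[ab0 abn].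
  by rewrite -ab0; apply: nP => //; rewrite ab0.
- apply/seteqP; split=> [y [n _]|y [a Fa <-]].
    have [_ _ ->] := wP n; move=> [a Fa <-].
    by exists (cons_baire n a).
  by exists (a 0) => //; have [_ _ ->] := wP (a 0); exists (behead_baire a).
Qed.

(** A point of the intersection is coded by a sequence of codes, one for each
    set, that all name the same point.  Hausdorffness makes this condition
    closed. *)
Lemma analytic_bigcap (A : nat -> set Y) : hausdorff_space Y ->
  (forall n, analytic (A n)) -> analytic (\bigcap_n A n).
Proof.
move=> hY /analytic_choice[w wP].
exists [set a | forall n, (w n).1 (row a n) /\
          (w n).2 (row a n) = (w 0).2 (row a 0)],
  (fun a => (w 0).2 (row a 0)); split.
- move=> a ha /=.
  have Fa n : (w n).1 (row a n).
    have [cF _ _] := wP n; apply: cF => m; have [N NP] := agree_row n m.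
    by have [b Fb /NP ab] := ha N; exists (row b n); first exact: (Fb n).1.
  move=> n; split=> //; apply: contrapT => neq.
  have [U [V [oU oV Ua Va UV]]] := hausdorff_separate hY neq.
  have [_ cfn _] := wP n; have [m mP] := cfn _ _ (Fa n) oU Ua.
  have [_ cf0 _] := wP 0; have [m' mP'] := cf0 _ _ (Fa 0) oV Va.
  have [N NP] := agree_row n m; have [N' NP'] := agree_row 0 m'.
  have [b Fb ab] := ha (maxn N N').
  apply: (UV ((w 0).2 (row b 0))).
    rewrite -(Fb n).2; apply: mP; first exact: (Fb n).1.
    by apply: NP; apply: agreeW ab; exact: leq_maxl.
  apply: mP'; first exact: (Fb 0).1.
  by apply: NP'; apply: agreeW ab; exact: leq_maxr.
- move=> a U Fa oU Ua; have [_ cf _] := wP 0.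
  have [m mP] := cf _ _ (Fa 0).1 oU Ua; have [N NP] := agree_row 0 m.
  by exists N => b Fb ab; apply: mP (NP _ _ ab); exact: (Fb 0).1.
- apply/seteqP; split=> [y Ay|y [a Fa <-] n _].
    have /choice[r rP] : forall n, exists a, (w n).1 a /\ (w n).2 a = y.
      move=> n; have := Ay n I; have [_ _ ->] := wP n.
      by move=> [a Fa ay]; exists a.
    exists (of_rows r) => [n|] /=; last by rewrite of_rowsK (rP 0).2.
    by rewrite !of_rowsK; split; [exact: (rP n).1|rewrite (rP n).2 (rP 0).2].
  by have [_ _ ->] := wP n; exists (row a n); [exact: (Fa n).1|exact: (Fa n).2].
Qed.

Lemma analyticU A B : analytic A -> analytic B -> analytic (A `|` B).
Proof.
move=> aA aB.
rewrite (_ : A `|` B = \bigcup_n (if n is 0 then A else B)).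
  by apply: analytic_bigcup => -[|n].
apply/seteqP; split=> [y [Ay|By]|y [[|n] _ Cy]]; first by exists 0.
- by exists 1.
- by left.
- by right.
Qed.

Lemma analyticI A B : hausdorff_space Y ->
  analytic A -> analytic B -> analytic (A `&` B).
Proof.
move=> hY aA aB.
rewrite (_ : A `&` B = \bigcap_n (if n is 0 then A else B)).
  by apply: analytic_bigcap => // -[|n].
apply/seteqP; split=> [y [Ay By] [|n] _//|y AB].
by split; [exact: (AB 0)|exact: (AB 1)].
Qed.

Lemma analytic_image (Z : topologicalType) (g : Y -> Z) A :
  continuous g -> analytic A -> analytic (g @` A).
Proof.
move=> cg [F [f [cF cf ->]]]; exists F, (g \o f); split=> //.
  move=> a U Fa oU Ua; apply: (cf a (g @^-1` U)) => //.
  exact: open_comp.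
by rewrite image_comp.
Qed.

Lemma analytic_closedI A B : analytic A -> closed B -> analytic (A `&` B).
Proof.
move=> [F [f [cF cf ->]]] clB; exists (F `&` f @^-1` B), f; split.
- move=> a ha.
  have Fa : F a by apply: cF => n; have [b [Fb _] ab] := ha n; exists b.
  split=> //; apply: contrapT => nB.
  have [n nP] := cf a (~` B) Fa (closed_openC clB) nB.
  have [b [Fb Bb] ab] := ha n; exact: nP ab Bb.
- move=> a U [Fa _] oU Ua; have [n nP] := cf _ _ Fa oU Ua.
  by exists n => b [Fb _] ; apply: nP.
- apply/seteqP; split=> [y [[a Fa <-] Ba]|y [a [Fa Ba] <-]]; first by exists a.
  by split=> //; exists a.
Qed.

(** By continuity a point of [B] has a code with a finite initial segment that
    already forces membership in [B]; prefixing the code by the length of such a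
    segment turns the open condition into a closed one. *)
Lemma analytic_openI A B : analytic A -> open B -> analytic (A `&` B).
Proof.
move=> [F [f [cF cf ->]]] oB.
exists [set a | F (behead_baire a) /\
    forall b, F b -> agree (a 0) (behead_baire a) b -> B (f b)],
  (f \o behead_baire); split.
- move=> a ha; split.
    apply: cF => n; have [b [Fb _] /agree_behead[_ ab]] := ha n.+1.
    by exists (behead_baire b).
  move=> c Fc ac; have [b [Fb bP] /agree_behead[ab0 ab]] := ha (a 0).+1.
  by apply: bP => // k; rewrite -ab0 => ka; rewrite -ab// ac.
- move=> a U [Fa _] oU Ua; have [n nP] := cf _ _ Fa oU Ua.
  by exists n.+1 => b [Fb _] /agree_behead[_]; exact: nP.
- apply/seteqP; split=> [y [[a Fa <-] Ba]|y [a [Fa aP] <-]].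
    have [n nP] := cf _ _ Fa oB Ba.
    by exists (cons_baire n a).
  by split; [exists (behead_baire a)|apply: aP].
Qed.

End AnalyticOps.

Lemma analyticX (Y Z : topologicalType) (A : set Y) (B : set Z) :
  analytic A -> analytic B -> analytic (A `*` B).
Proof.
move=> [F [f [cF cf ->]]] [G [g [cG cg ->]]].
exists [set a | F (row a 0) /\ G (row a 1)],
  (fun a => (f (row a 0), g (row a 1))); split.
- move=> a ha; split.
    apply: cF => m; have [N NP] := agree_row 0 m.
    by have [b [Fb _] /NP] := ha N; exists (row b 0).
  apply: cG => m; have [N NP] := agree_row 1 m.
  by have [b [_ Gb] /NP] := ha N; exists (row b 1).
- move=> a U [Fa Ga] oU Ua.
  have [[V W] /= [nV nW] VWU] : nbhs (f (row a 0), g (row a 1)) U.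
    exact: open_nbhs_nbhs.
  move: nV nW; rewrite !nbhsE /= => -[V' [oV' V'a] V'V] [W' [oW' W'a] W'W].
  have [m mP] := cf _ _ Fa oV' V'a; have [m' mP'] := cg _ _ Ga oW' W'a.
  have [N NP] := agree_row 0 m; have [N' NP'] := agree_row 1 m'.
  exists (maxn N N') => b [Fb Gb] ab; apply: VWU; split=> /=.
    apply/V'V/mP => //.
    by apply: NP; apply: agreeW ab; exact: leq_maxl.
  apply/W'W/mP' => //.
  by apply: NP'; apply: agreeW ab; exact: leq_maxr.
- apply/seteqP; split=> [[y z] [/= [a Fa <-] [b Gb <-]]|_ [a [Fa Ga] <-]].
    exists (of_rows (fun n => if n is 0 then a else b)) => /=;
      by rewrite !of_rowsK.
  by split=> /=; [exists (row a 0)|exists (row a 1)].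
Qed.

Section BorelAnalytic.
Context {Y : topologicalType} (hY : hausdorff_space Y).
Hypothesis aY : analytic [set: Y].

(** Induction on Borel sets needs a hypothesis that is stable under complement,
    so analyticity is proved for the set and for its complement together. *)
Lemma borel_analytic (A : set Y) : borel A -> analytic A.
Proof.
move=> bA; suff [] : analytic A /\ analytic (~` A) by [].
have aopen (U : set Y) : open U -> analytic U.
  by move=> oU; rewrite -[U]setTI; exact: analytic_openI.
move: A bA; apply: borel_ind => [U oU|B [aB aB']|B aB].
- split; first exact: aopen.
  by rewrite -[~` U]setTI; apply: analytic_closedI => //; exact: open_closedC.
- by rewrite setCK.
- split; first by apply: analytic_bigcup => n; exact: (aB n).1.
  by rewrite setC_bigcup; apply: analytic_bigcap => // n; exact: (aB n).2.
Qed.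

End BorelAnalytic.

(** * Novikov separation *)

Definition novikov_separable (Y : topologicalType) (A : nat -> set Y) :=
  exists B : nat -> set Y, [/\ forall n, borel (B n), forall n, A n `<=` B n &
    forall y, ~ forall n, B n y].

(** The induction step of Novikov's theorem.  Splitting the single set [A m]
    into countably many pieces preserves separability: take the union over the
    pieces of the enclosing sets in position [m], and the intersection elsewhere. *)
Lemma novikov_separable_bigcup (Y : topologicalType) (A : nat -> set Y) m
    (C : nat -> nat -> set Y) :
  A m `<=` \bigcup_k C k m -> (forall n k, n <> m -> A n `<=` C k n) ->
  (forall k, novikov_separable (C k)) -> novikov_separable A.
Proof.
move=> Am An /choice[B BP].
exists (fun n => if n == m then \bigcup_k B k m else \bigcap_k B k n); split.
- move=> n; case: ifP => _.
    by apply: borel_bigcup => k; have [] := BP k.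
  by apply: borel_bigcap => k; have [] := BP k.
- move=> n; case: eqP => [->|nm] y Ay.
    by have [k _ Cy] := Am _ Ay; exists k => //; have [_ + _] := BP k; apply.
  by move=> k _; have [_ + _] := BP k; apply; apply: An Ay.
- move=> y Dy; have := Dy m; rewrite eqxx => -[k _ By].
  have [_ _ /(_ y)] := BP k; apply=> n.
  by have := Dy n; case: eqP => [->//|_]; apply.
Qed.

(** Dependent choice along initial segments. *)
Lemma baire_branch (P : seq nat -> Prop) :
  P [::] -> (forall s, P s -> exists k, P (rcons s k)) ->
  exists a : baire, forall n, P (mkseq a n).
Proof.
move=> P0 PS.
have /choice[g gP] : forall s, exists k, P s -> P (rcons s k).
  move=> s; have [/PS[k Pk]|nP] := pselect (P s); first by exists k.
  by exists 0.
pose s n := iter n (fun s => rcons s (g s)) [::].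
exists (fun n => g (s n)) => n.
have -> : mkseq (fun n => g (s n)) n = s n.
  by elim: n => //= n IH; rewrite mkseqS IH.
by elim: n => //= n IH; apply: gP.
Qed.

Lemma mkseq_agree n a b : mkseq a n = mkseq b n <-> agree n a b.
Proof.
split=> [ab k kn|ab]; first by rewrite -(nth_mkseq 0 a kn) ab nth_mkseq.
apply: (@eq_from_nth _ 0); rewrite !size_mkseq// => k kn.
by rewrite !nth_mkseq// ab.
Qed.

(** If the sets are not separable, restrict all the coding maps at once to the
    codes whose interleaving starts with a given finite sequence.  Lengthening
    the sequence by one entry splits just one of the sets, so it can be done
    without making the family separable.  In the limit this gives one code for
    each set.  If they name two different points, disjoint open neighbourhoods
    separate the family at a finite stage; otherwise the common point lies in
    every set. *)
Lemma novikov_separation (Y : topologicalType) (A : nat -> set Y) :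
  hausdorff_space Y -> (forall n, analytic (A n)) ->
  (forall y, ~ forall n, A n y) -> novikov_separable A.
Proof.
move=> hY /analytic_choice[w wP] A0.
pose C (s : seq nat) n := [set (w n).2 (row a n) | a in
  [set a | mkseq a (size s) = s /\ (w n).1 (row a n)]].
apply: contrapT => nsepA.
have [||a aP] := @baire_branch (fun s => ~ novikov_separable (C s)).
- move=> [B [bB CB B0]]; apply: nsepA; exists B; split=> // n.
  apply: subset_trans (CB n); have [_ _ ->] := wP n => y [a Fa <-].
  by exists (of_rows (fun=> a)); rewrite /= ?of_rowsK.
- move=> s nsep; apply: contrapT => /forallNP sep; apply: nsep.
  (* No code but that of [A m] uses the entry at position [size s]. *)
  pose m := (odflt (0, 0) (unpickle (size s))).1.
  apply: (@novikov_separable_bigcup _ _ m (fun k => C (rcons s k))).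
  + move=> y [a [as_ Fa] <-]; exists (a (size s)) => //.
    by exists a; rewrite //= size_rcons mkseqS as_.
  + move=> n k nm y [a [as_ Fa] <-].
    pose b : baire := fun i => if i == size s then k else a i.
    have rb : row b n = row a n.
      apply/funext => i; rewrite /row /b; case: eqP => // e.
      by case: nm; rewrite /m -e pickleK.
    exists b; rewrite /= rb//; split=> //.
    rewrite size_rcons mkseqS {2}/b eqxx -[in RHS]as_; congr rcons.
    by apply/mkseq_agree => i ilt; rewrite /b ltn_eqF.
  + by move=> k; apply: contrapT => /(sep k).
(* Otherwise some restricted set is empty, which separates the family. *)
have aF n : (w n).1 (row a n).
  have [cF _ _] := wP n; apply: cF => m; apply: contrapT => noapprox.
  have [N NP] := agree_row n m.
  apply: (aP N); exists (fun i => if i == n then set0 else setT); split.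
  + by move=> i; case: ifP => _; [exact: borel_set0|exact: borel_setT].
  + move=> i; case: eqP => [->|//] y [b [bs Fb] _]; case: noapprox.
    exists (row b n) => //; apply: NP; apply/mkseq_agree.
    by rewrite size_mkseq in bs.
  + by move=> y /(_ n); rewrite eqxx.
apply: (A0 ((w 0).2 (row a 0))) => n.
suff <- : (w n).2 (row a n) = (w 0).2 (row a 0).
  by have [_ _ ->] := wP n; exists (row a n).
apply: contrapT => neq.
have [U [V [oU oV Ua Va UV]]] := hausdorff_separate hY neq.
have [_ cfn _] := wP n; have [m mP] := cfn _ _ (aF n) oU Ua.
have [_ cf0 _] := wP 0; have [m' mP'] := cf0 _ _ (aF 0) oV Va.
have [N NP] := agree_row n m; have [N' NP'] := agree_row 0 m'.
apply: (aP (maxn N N')).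
exists (fun i => if i == n then U else if i == 0 then V else setT); split.
- by move=> i; do 2?case: ifP => _; apply: borel_open => //; exact: openT.
- move=> i; case: eqP => [->|_]; last case: eqP => [->|//].
    move=> _ [b [/= + Fb] <-]; rewrite size_mkseq => /esym/mkseq_agree ab.
    by apply: mP => //; apply: NP; apply: agreeW ab; exact: leq_maxl.
  move=> _ [b [/= + Fb] <-]; rewrite size_mkseq => /esym/mkseq_agree ab.
  by apply: mP' => //; apply: NP'; apply: agreeW ab; exact: leq_maxr.
- move=> y By; have := By n; have := By 0; rewrite eqxx.
  case: (eqVneq 0 n) => [n0|_]; last by rewrite eqxx => Vy Uy; exact: UV Vy.
  by case: neq; rewrite -n0.
Qed.

(** Novikov's theorem for the sequence [A, A', A', ...]. *)
Lemma lusin_separation (Y : topologicalType) (A A' : set Y) :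
  hausdorff_space Y -> analytic A -> analytic A' ->
  (forall y, A y -> A' y -> False) ->
  exists B, [/\ borel B, A `<=` B & forall y, B y -> A' y -> False].
Proof.
move=> hY aA aA' AA'.
have [||B [bB AB B0]] :=
  @novikov_separation _ (fun n => if n is 0 then A else A') hY.
- by case.
- by move=> y Ay; apply: AA' (Ay 0) (Ay 1).
exists (B 0); split=> //; first exact: (AB 0).
by move=> y By A'y; apply: (B0 y) => -[//|n]; apply: (AB n.+1).
Qed.

(** * Polish spaces *)

Section Polish.
Import Order.TTheory GRing.Theory Num.Theory.
Local Open Scope ring_scope.
Context {R : realType} {X : topologicalType} (d : X -> X -> R).
Hypotheses (dM : is_metric d) (dC : metric_compatible d).

Let d0 x : d x x = 0. Proof. by case: dM. Qed.
Let dsym x y : d x y = d y x. Proof. by case: dM. Qed.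
Let dtri y x z : d x z <= d x y + d y z. Proof. by case: dM. Qed.

Lemma metric_ball_open x e : open [set y | d x y < e].
Proof.
apply/dC => y /= xy; exists (e - d x y); first by rewrite subr_gt0.
move=> z /= yz; apply: le_lt_trans (dtri y x z) _.
by rewrite addrC -ltrBrDr.
Qed.

Lemma metric_ge0 x y : 0 <= d x y.
Proof.
have := dtri y x x; rewrite d0 (dsym y x) -mulr2n.
by rewrite pmulrn_lge0.
Qed.

Lemma compatible_metric_hausdorff : hausdorff_space X.
Proof.
move=> x y xy; have [_ d_eq _ _] := dM; apply: d_eq; apply: contrapT => dxy.
have dxy0 : 0 < d x y / 2.
  by rewrite divr_gt0// lt_neqAle metric_ge0 andbT eq_sym; apply/eqP.
have nb z : nbhs z [set w | d z w < d x y / 2].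
  by apply: open_nbhs_nbhs; split; [exact: metric_ball_open|rewrite /= d0].
have [z [/= xz yz]] := xy _ _ (nb x) (nb y).
have := dtri z x y; rewrite leNgt (dsym z y) => /negP; apply.
by rewrite [ltRHS]splitr ltrD.
Qed.

Lemma inv_succ_lt (e : R) : 0 < e -> exists n : nat, n.+1%:R^-1 < e.
Proof.
move=> e0; exists (Num.truncn e^-1).
rewrite invf_plt ?posrE//; exact: truncnS_gt.
Qed.

Lemma metric_dense_base (q : nat -> X) :
  (forall O : set X, open O -> O !=set0 -> exists n, O (q n)) ->
  exists U : nat -> set X, (forall n, open (U n)) /\
    forall O x, open O -> O x -> exists2 n, U n x & U n `<=` O.
Proof.
move=> qP; pose U (p : nat * nat) := [set y | d (q p.1) y < p.2.+1%:R^-1].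
exists (fun n => U (odflt (0, 0)%N (unpickle n))); split.
  by move=> n; exact: metric_ball_open.
move=> O x oO Ox; have [e e0 eO] := (dC O).1 oO x Ox.
have [k ke] : exists k : nat, k.+1%:R^-1 < e / 2.
  by apply: inv_succ_lt; rewrite divr_gt0.
have k0 : 0 < k.+1%:R^-1 :> R by rewrite invr_gt0.
have [|n nx] := qP _ (metric_ball_open x k.+1%:R^-1).
  by exists x; rewrite /= d0.
exists (pickle (n, k)); rewrite pickleK /U /=; first by rewrite dsym.
move=> y /= ny; apply: eO => /=; apply: le_lt_trans (dtri (q n) x y) _.
by rewrite [ltRHS]splitr ltrD// (lt_trans _ ke).
Qed.

(** The codes are the subsequences of [q] that are Cauchy with modulus
    [1 / (m + 1)]: a closed condition, on which taking the limit is
    continuous. *)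
Lemma complete_metric_analytic (q : nat -> X) : metric_complete d ->
  (forall O : set X, open O -> O !=set0 -> exists n, O (q n)) ->
  analytic [set: X].
Proof.
move=> dK qP.
pose F : set baire := [set a | forall m n, (m <= n)%N ->
  d (q (a m)) (q (a n)) <= m.+1%:R^-1].
have limF (a : baire) : exists l, F a ->
    forall O, open O -> O l -> exists N, forall n, (N <= n)%N -> O (q (a n)).
  have [Fa|nFa] := pselect (F a); last by exists (q 0%N).
  have [|l lP] := dK (q \o a); last first.
    exists l => _ O oO Ol.
    have [N _ NP] := lP _ (open_nbhs_nbhs (conj oO Ol)).
    by exists N => n; exact: NP.
  move=> e /inv_succ_lt[N Ne]; exists N => m n Nm Nn /=.
  wlog mn : m n Nm Nn / (m <= n)%N.
    by move=> H; case/orP: (leq_total m n) => ?; [|rewrite dsym]; exact: H.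
  apply: le_lt_trans Ne; apply: le_trans (Fa _ _ mn) _.
  by rewrite lef_pV2 ?posrE// ler_nat.
have [f fP] := choice limF.
have fdist a n : F a -> d (q (a n)) (f a) <= n.+1%:R^-1.
  move=> Fa; apply/ler_addgt0Pr => e e0.
  have [|N NP] := fP a Fa _ (metric_ball_open (f a) e); first by rewrite /= d0.
  apply: le_trans (dtri (q (a (maxn N n))) _ _) _; apply: lerD.
    exact/Fa/leq_maxr.
  by rewrite dsym; exact/ltW/NP/leq_maxl.
exists F, f; split.
- move=> a ha m n mn; have [b Fb ab] := ha n.+1.
  by rewrite !ab//; exact: Fb.
- move=> a U Fa oU Ua; have [e e0 eU] := (dC U).1 oU _ Ua.
  have [n ne] : exists n : nat, n.+1%:R^-1 < e / 2.
    by apply: inv_succ_lt; rewrite divr_gt0.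
  exists n.+1 => b Fb ab; apply: eU => /=.
  apply: le_lt_trans (dtri (q (a n)) _ _) _; rewrite [ltRHS]splitr.
  rewrite ltrD//; first by rewrite dsym; exact: le_lt_trans (fdist _ _ Fa) _.
  by rewrite ab//; exact: le_lt_trans (fdist _ _ Fb) _.
- apply/seteqP; split=> // x _.
  (* The factor 2 is spent on the triangle inequality through [x]. *)
  have /choice[a aP] (n : nat) : exists k, d x (q k) < n.+1%:R^-1 / 2.
    have [||k] := qP [set y | d x y < n.+1%:R^-1 / 2]; last by exists k.
      exact: metric_ball_open.
    by exists x; rewrite /= d0 divr_gt0.
  have Fa : F a.
    move=> m n mn; apply: le_trans (dtri x _ _) _; rewrite [leRHS]splitr.
    rewrite lerD// ltW//; first by rewrite dsym.
    apply: lt_le_trans (aP n) _.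
    by rewrite ler_pM2r// lef_pV2 ?posrE// ler_nat.
  exists a => //; have [_ d_eq _ _] := dM; apply: d_eq.
  apply/eqP; rewrite eq_le metric_ge0 andbT; apply/ler_addgt0Pr => e e0.
  rewrite add0r; have [n ne] : exists n : nat, n.+1%:R^-1 < e / 2.
    by apply: inv_succ_lt; rewrite divr_gt0.
  apply: le_trans (dtri (q (a n)) _ _) _; rewrite [leRHS]splitr lerD//.
    by rewrite dsym; exact/ltW/(le_lt_trans (fdist _ _ Fa)).
  rewrite dsym; apply/ltW/(lt_trans (aP n)).
  by apply: le_lt_trans ne; rewrite ler_piMr// invf_le1// ler1n.
Qed.

End Polish.

Lemma dense_sequence (X : topologicalType) (D : set X) (x0 : X) :
  countable D -> dense D ->
  exists q : nat -> X,
    forall O : set X, open O -> O !=set0 -> exists n, O (q n).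
Proof.
move=> /pfcard_geP[D0|[q]] dD.
  have [||x [_]] := dD [set: X]; [by exists x0|exact: openT|by rewrite D0].
exists q => O oO O0; have [//|//|x [Ox Dx]] := dD O.
by have [n _ nx] := 'surj_q Dx; exists n; rewrite nx.
Qed.

(** * Borel upper sets *)

Definition upper_set (X : Type) (le : rel X) (B : set X) :=
  forall x y, B x -> le x y -> B y.

Section UpperSets.
Context {X : topologicalType} (hX : hausdorff_space X).
Hypothesis aX : analytic [set: X].
Variable le : rel X.
Hypotheses (le_qo : quasi_order le) (le_borel : borel_rel le).

Let le_refl : reflexive le := le_qo.1.
Let le_trans : transitive le := le_qo.2.

Let hXX : hausdorff_space (X * X)%type.
Proof. exact: hausdorff_prod. Qed.

Let aXX : analytic [set: (X * X)%type].
Proof. by rewrite -setXTT; exact: analyticX. Qed.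

Let continuous_fst : continuous (@fst X X).
Proof. by move=> p; exact: cvg_fst. Qed.

Let continuous_snd : continuous (@snd X X).
Proof. by move=> p; exact: cvg_snd. Qed.

Let a_le : analytic [set p : X * X | le p.1 p.2].
Proof. exact: borel_analytic. Qed.

Lemma analytic_upper_closure A :
  analytic A -> analytic [set y | exists2 x, A x & le x y].
Proof.
move=> aA; rewrite (_ : [set y | _] =
    snd @` ([set p : X * X | le p.1 p.2] `&` (A `*` setT))).
  by apply: analytic_image => //; apply: analyticI => //; exact: analyticX.
apply/seteqP; split=> [y [x Ax xy]|_ [[x y] [/= xy [Ax _]] <-]].
  by exists (x, y).
by exists x.
Qed.

Lemma analytic_lower_closure A :
  analytic A -> analytic [set x | exists2 y, A y & le x y].
Proof.
move=> aA; rewrite (_ : [set y | _] =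
    fst @` ([set p : X * X | le p.1 p.2] `&` (setT `*` A))).
  by apply: analytic_image => //; apply: analyticI => //; exact: analyticX.
apply/seteqP; split=> [x [y Ay xy]|_ [[x y] [/= xy [_ Ay]] <-]].
  by exists (x, y).
by exists y.
Qed.

(** A Borel set [C] that is disjoint from the lower closure [L] of [A'] has an
    analytic upper closure still disjoint from [L], so Lusin's theorem encloses
    this closure in another Borel set disjoint from [L].  The union of the sets
    obtained by iterating, starting from [A], is an upper set. *)
Lemma upper_set_separation A A' : analytic A -> analytic A' ->
  (forall x y, A x -> A' y -> ~~ le x y) ->
  exists B, [/\ borel B, upper_set le B, A `<=` B &
    forall y, B y -> A' y -> False].
Proof.
move=> aA aA' AA'.
pose L : set X := [set x | exists2 y, A' y & le x y].
have aL : analytic L by exact: analytic_lower_closure.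
have /choice[g gP] : forall C : set X, exists B : set X,
    analytic C -> (forall x, C x -> L x -> False) ->
    [/\ borel B, (forall x y, C x -> le x y -> B y) &
      forall x, B x -> L x -> False].
  move=> C; have [[aC CL]|nC] :=
    pselect (analytic C /\ forall x, C x -> L x -> False); last first.
    by exists set0 => aC CL; case: nC.
  have [|B [bB CB BL]] :=
    @lusin_separation _ _ _ hX (analytic_upper_closure aC) aL.
    move=> y [x Cx xy] [z A'z yz].
    by apply: (CL x Cx); exists z => //; exact: le_trans yz.
  by exists B => _ _; split=> // x y Cx xy; apply: CB; exists x.
have AL x : A x -> L x -> False.
  by move=> Ax [y A'y]; apply/negP/AA'.
pose B n := iter n.+1 g A.
have BP n : borel (B n) /\ forall x, B n x -> L x -> False.
  elim: n => [|n [bB BL]]; first by have [] := gP _ aA AL.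
  by have [] := gP _ (borel_analytic hX aX bB) BL.
exists (\bigcup_n B n); split.
- by apply: borel_bigcup => n; exact: (BP n).1.
- move=> x y [n _ Bx] xy; exists n.+1 => //.
  have [bB BL] := BP n.
  have [_ gB _] := gP _ (borel_analytic hX aX bB) BL; exact: gB Bx xy.
- move=> x Ax; exists 0 => //.
  have [_ gA _] := gP _ aA AL; exact: gA Ax (le_refl x).
- by move=> y [n _ By] A'y; apply: (BP n).2 By _; exists y.
Qed.

(** The complement of [le] is a Borel set with open sections; the proof is that
    of the Kunen-Novikov theorem, which writes such a set as a countable union
    of rectangles, except that one side of the rectangles is left analytic. *)
Lemma separating_upper_sets (U : nat -> set X) :
  (forall n, open (U n)) ->
  (forall O x, open O -> O x -> exists2 n, U n x & U n `<=` O) ->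
  (forall y, closed [set x | le x y]) ->
  exists B : nat -> set X,
    [/\ forall n, borel (B n), forall n, upper_set le (B n) &
      forall x y, ~~ le x y -> exists n, B n x /\ ~ B n y].
Proof.
move=> oU baseU lower_closed.
pose W : set (X * X) := ~` [set p | le p.1 p.2].
have bW : borel W by exact: borel_setC.
pose P n : set X := [set y | exists2 x, U n x & le x y].
have aU n : analytic (U n) by apply: borel_analytic => //; exact: borel_open.
have aP n : analytic (P n) by exact: analytic_upper_closure.
pose E n : set (X * X) := W `&` ((setT `*` P n) `|` (fst @^-1` (~` U n))).
have [||B [bB EB B0]] := @novikov_separation _ E hXX.
- move=> n; apply: analyticI => //; first exact: borel_analytic.
  apply: analyticU; first exact: analyticX.
  apply: borel_analytic => //; apply: borel_preimage => //.
  by apply: borel_setC; exact: borel_open.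
- move=> [x y] Exy.
  have Wxy : ~ le x y by case: (Exy 0).
  have [n Ux Un] := baseU _ x (closed_openC (lower_closed y)) Wxy.
  by have [_ [[_ [z /Un]]|]] := Exy n.
pose A' n : set X := snd @` (W `&` ~` B n).
have aA' n : analytic (A' n).
  apply: analytic_image => //; apply: borel_analytic => //.
  by apply: borelI => //; exact: borel_setC.
(* Outside [B n] the pair lies in the rectangle [U n * ~` P n]. *)
have WB n x y : ~ le x y -> ~ B n (x, y) -> U n x /\ ~ P n y.
  move=> Wxy nB; split; apply: contrapT => H; apply/nB/EB; split=> //.
    by right.
  by left; split=> //; exact: contrapT.
have /choice[C CP] n : exists C, [/\ borel C, upper_set le C, U n `<=` C &
    forall y, C y -> A' n y -> False].
  apply: upper_set_separation => // x y Ux [[x' y'] [/= W' nB'] <-].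
  by have [_ nP] := WB _ _ _ W' nB'; apply/negP => xy; apply: nP; exists x.
exists C; split=> [n|n|x y /negP xy]; [by case: (CP n)|by case: (CP n)|].
have [n nB] : exists n, ~ B n (x, y) by apply/existsNP/B0.
have [Ux _] := WB _ _ _ xy nB; have [_ _ UC CA'] := CP n.
exists n; split; first exact: UC.
by move=> Cy; apply: CA' Cy _; exists (x, y).
Qed.

End UpperSets.

(** * Prioritizing an upper set *)

Definition prioritize (X : Type) (B : set X) (le : rel X) : rel X :=
  fun x y => (x \notin B) && (y \in B) || ((x \in B) == (y \in B)) && le x y.

Section Prioritize.
Context {X : Type} {le : rel X} {B : set X}.
Hypotheses (le_qo : quasi_order le) (le_B : upper_set le B).

Lemma prioritize_quasi_order : quasi_order (prioritize B le).
Proof.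
have [le_refl le_trans] := le_qo; split=> [x|y x z].
  by rewrite /prioritize eqxx le_refl orbT.
rewrite /prioritize; have := @le_trans y x z.
case: (x \in B); case: (y \in B); case: (z \in B) => //=.
all: do 2!case: (le _ _) => //; by move=> H _; apply: H.
Qed.

Lemma upper_set_in x y : le x y -> x \in B -> y \in B.
Proof. by move=> xy /set_mem Bx; apply/mem_set/(le_B Bx). Qed.

Lemma prioritize_equiv : qo_equiv (prioritize B le) =2 qo_equiv le.
Proof.
move=> x y; rewrite /qo_equiv /prioritize.
have := @upper_set_in x y; have := @upper_set_in y x.
case: (x \in B); case: (y \in B); case: (le x y); case: (le y x) => //=.
all: by move=> H1 H2; first [have := H1 isT isT|have := H2 isT isT].
Qed.

Lemma prioritize_lt x y : qo_lt le x y -> qo_lt (prioritize B le) x y.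
Proof.
rewrite /qo_lt /prioritize.
have := @upper_set_in x y.
case: (x \in B); case: (y \in B); case: (le x y); case: (le y x) => //=.
by move=> H; have := H isT isT.
Qed.

Lemma prioritize_notin_in x y :
  ~ B x -> B y -> qo_lt (prioritize B le) x y.
Proof.
move=> nBx By; have xB : (x \in B) = false by apply/negP => /set_mem.
by rewrite /qo_lt /prioritize xB (mem_set By).
Qed.

End Prioritize.

Lemma prioritize_borel (X : topologicalType) (le : rel X) (B : set X) :
  borel B -> borel_rel le -> borel_rel (prioritize B le).
Proof.
move=> bB ble.
have b1 : borel (fst @^-1` B : set (X * X)).
  by apply: borel_preimage bB => p; exact: cvg_fst.
have b2 : borel (snd @^-1` B : set (X * X)).
  by apply: borel_preimage bB => p; exact: cvg_snd.
rewrite /borel_rel (_ : [set p | _] =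
  ~` (fst @^-1` B) `&` (snd @^-1` B) `|`
  ((fst @^-1` B) `&` (snd @^-1` B) `|`
    ~` (fst @^-1` B) `&` ~` (snd @^-1` B)) `&` [set p | le p.1 p.2]).
  have bC1 := borel_setC b1; have bC2 := borel_setC b2.
  apply: borelU; first exact: borelI.
  by apply: borelI => //; apply: borelU; exact: borelI.
have inP x : reflect (B x) (x \in B).
  by apply: (iffP idP) => [/set_mem|/mem_set].
apply/seteqP; split=> -[x y]; rewrite /prioritize /=.
  by case: (inP x) => Bx; case: (inP y) => By //= xy;
    try (by left); right; split=> //; [left|right].
by case: (inP x) => Bx; case: (inP y) => By //=; move=> [[]|[[[]|[]]]].
Qed.

(** * Realizers *)

Section Quotient.
Context {X : Type} {le le' : rel X}.
Hypotheses (le_qo : quasi_order le) (le'_qo : quasi_order le').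
Hypothesis le'E : qo_equiv le' =2 qo_equiv le.

Lemma cls_eq x y : cls le x = cls le y <-> qo_equiv le x y.
Proof.
have [le_refl le_trans] := le_qo; split=> [[/seteqP[_ H]]|xy].
  by apply: (H y); rewrite /eclass /= /qo_equiv le_refl.
apply: val_inj => /=; move: xy => /andP[xy yx].
apply/seteqP; split=> z /andP[a b]; apply/andP; split.
- exact: le_trans a.
- exact: le_trans b _.
- exact: le_trans a.
- exact: le_trans b _.
Qed.

(** The induced order can be read off any representatives. *)
Lemma induced_lt_cls x y :
  induced_lt le le' (cls le x) (cls le y) = qo_lt le' x y.
Proof.
have [_ le_trans] := le'_qo.
apply/asboolP/idP => [[x' [y' []]]|xy]; last by exists x, y.
move=> /cls_eq + /cls_eq; rewrite -!le'E => /andP[xx' x'x] /andP[yy' y'y].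
move=> /andP[xy' y'x']; apply/andP; split.
  exact: le_trans (le_trans _ _ _ xx' xy') y'y.
apply: contra y'x' => yx.
exact: le_trans (le_trans _ _ _ y'y yx) xx'.
Qed.

Lemma cls_surj (a : quot le) : exists x, a = cls le x.
Proof.
case: a => A mA; have [x _ xA] := set_mem mA; exists x.
exact: val_inj.
Qed.

Lemma induced_lt_partial_order : partial_order (induced_lt le le').
Proof.
have [_ le_trans] := le'_qo; split=> [a|b a c].
  by have [x ->] := cls_surj a; rewrite induced_lt_cls /qo_lt andbN.
have [x ->] := cls_surj a; have [y ->] := cls_surj b; have [z ->] := cls_surj c.
rewrite !induced_lt_cls => /andP[xy yx] /andP[yz zy]; apply/andP; split.
  exact: le_trans xy yz.
by apply: contra yx => zx; exact: le_trans zx.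
Qed.

End Quotient.

Section BorelRealizer.
Context {X : topologicalType} {le : rel X}.
Hypothesis le_borel : borel_quasi_order le.

Lemma upper_sets_realizer (B : nat -> set X) :
  (forall n, borel (B n)) -> (forall n, upper_set le (B n)) ->
  (forall x y, ~~ le x y -> exists n, B n x /\ ~ B n y) ->
  borel_realizer [set: nat] (fun n => induced_lt le (prioritize (B n) le)).
Proof.
have [le_qo ble] := le_borel => bB uB sepB.
have qoB n := @prioritize_quasi_order _ _ (B n) le_qo.
have eqB n := @prioritize_equiv _ _ _ (uB n).
split=> [n _|x y].
  split; first split.
  - exact: induced_lt_partial_order.
  - exists (prioritize (B n) le); split=> //; split=> //.
    exact: prioritize_borel.
  - move=> a b; have [x ->] := cls_surj a; have [y ->] := cls_surj b.
    rewrite /quot_lt !induced_lt_cls//; exact: prioritize_lt.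
have [xy|/sepB[n [Bx By]]] := boolP (le x y); last first.
  exists n => //; apply: Or31; rewrite induced_lt_cls//.
  exact: prioritize_notin_in.
exists 0 => //; have [yx|yx] := boolP (le y x).
  by apply: Or33; apply/cls_eq => //; rewrite /qo_equiv xy.
by apply: Or32; rewrite /quot_lt induced_lt_cls// /qo_lt xy.
Qed.

Lemma borel_realizer_card_eq (T : Type) (U : pointedType)
    (K : set T) (L : set U)
    (lts : T -> rel (quot le)) :
  K #= L -> borel_realizer K lts ->
  exists lts' : U -> rel (quot le), borel_realizer L lts'.
Proof.
move=> /card_set_bijP[f [fKL f_inj f_surj]] [Klt Kcov].
have /choice[lts' ltsP] u :
    exists r, L u -> exists t, [/\ K t, f t = u & r = lts t].
  have [/f_surj[t Kt ft]|] := pselect (L u); last by exists (fun _ _ => false).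
  by exists (lts t) => _; exists t.
exists lts'; split=> [u /ltsP[t [Kt _ ->]]|x y]; first exact: Klt.
have [t Kt xy] := Kcov x y; exists (f t); first exact: fKL.
have [t' [Kt' tt' ->]] := ltsP _ (fKL _ Kt).
suff -> : t' = t by [].
by apply: f_inj; rewrite ?inE.
Qed.

End BorelRealizer.

(** The witness is either the least finite cardinal satisfying [P] or, when
    there is none, the countable one. *)
Lemma card_minimum_countable (P : forall T : Type, set T -> Prop) :
  (forall T (U : pointedType) (K : set T) (L : set U),
    K #= L -> P T K -> P U L) ->
  P nat setT ->
  exists K : set nat,
    P nat K /\ forall U (L : set U), P U L -> K #<= L.
Proof.
move=> P_eq PT; have [[n Pn]|nofin] := pselect (exists n, P nat `I_n).
  have ex : exists n, `[< P nat `I_n >] by exists n; apply/asboolP.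
  case: (ex_minnP ex) => m /asboolP Pm mmin.
  exists `I_m; split=> // U L PL; have [finL|] := pselect (finite_set L).
    have [k Lk] := finL.
    have mk : (m <= k)%N by apply/mmin/asboolP/(P_eq _ _ _ _ Lk).
    by rewrite (card_le_eqr Lk) card_le_II.
  move=> /infiniteP; apply: card_le_trans.
  exact/subset_card_le.
exists setT; split=> // U L PL; apply/infiniteP => -[k Lk].
by apply: nofin; exists k; exact: P_eq PL.
Qed.

Theorem theorem4p9 (R : realType) (X : topologicalType) (le : rel X)
    (X_polish : polish R X)
    (le_borel : borel_quasi_order le)
    (le_lfin : locally_finite le) :
  exists (T : Type) (K : set T), borel_odim le K /\ K #<= [set: nat].
Proof.
have [le_qo ble] := le_borel.
have [B [bB uB sepB]] : exists B : nat -> set X,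
    [/\ forall n, borel (B n), forall n, upper_set le (B n) &
      forall x y, ~~ le x y -> exists n, B n x /\ ~ B n y].
  have [[x0 _]|noX] := pselect (exists x : X, True); last first.
    exists (fun=> set0); split=> [n|n x y []|x]; first exact: borel_set0.
    by case: noX; exists x.
  have [[D cD dD] [d [dM dC dK]]] := X_polish.
  have [q qP] := dense_sequence x0 cD dD.
  have hX := compatible_metric_hausdorff dM dC.
  have aX := complete_metric_analytic dM dC dK qP.
  have [U [oU baseU]] := metric_dense_base dM dC qP.
  apply: (separating_upper_sets hX aX le_qo ble oU baseU) => y.
  exact: (accessible_finite_set_closed.1 (hausdorff_accessible hX)).
have [K [[lts ltsP] Kmin]] := @card_minimum_countable
  (fun T K => exists lts : T -> rel (quot le), borel_realizer K lts)
  (fun T U K L KL '(ex_intro lts ltsP) => borel_realizer_card_eq KL ltsP)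
  (ex_intro _ _ (upper_sets_realizer le_borel bB uB sepB)).
exists nat, K; split; last exact/subset_card_le.
by split=> //; exists lts.
Qed.
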